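(* Let $\lambda,\eta,\delta\in\mathbb{R}\setminus\{0\}$ and $\sigma\in\mathbb{R}$. Let $$X(x)=\begin{cases}\frac{\delta}{\sqrt{\sigma}}\sinh(\sqrt{\sigma}\,x) & \text{if }\sigma>0,\\ \frac{\delta}{\sqrt{|\sigma|}}\sin(\sqrt{|\sigma|}\,x) & \text{if }\sigma<0,\\ \delta x & \text{if }\sigma=0,\end{cases}\qquad x\ge 0,$$ let $F=F(V,t)$ be a given real function, and let $T$ be the solution of the initial value problem $$\dot T(t)-\sigma T(t)=-\lambda F(\delta T(t),t),\quad t>0,\qquad T(0)=\eta.$$ If $\Phi(x)=\lambda X(x)$ and $h(x)=\eta X(x)$ for $x>0$, then the function $$u(x,t)=X(x)T(t),\qquad x\ge 0,\ t\ge 0,$$ is a solution (with separated variables) to Problem P with data $\Phi$, $F$, $h$.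
   Context: Problem P with data $\Phi,F,h$: find $u=u(x,t)$, $x\ge 0$, $t\ge 0$, such that $u_t(x,t)-u_{xx}(x,t)=-\Phi(x)F(u_x(0,t),t)$ for $x>0$, $t>0$; $u(x,0)=h(x)$ for $x>0$; $u(0,t)=0$ for $t>0$. Here $\Phi,h$ are real functions defined for $x>0$, $F$ is a real function defined for $V\in\mathbb{R}$, $t>0$, and $\lim_{x\to0^+}h(x)=0$. *)

(* Defs.v *)
From Stdlib Require Import Reals.
From Coquelicot Require Import Coquelicot.
Open Scope R_scope.

(** Functions given only on part of the line (or plane) are represented by total
    functions; every notion below depends only on their values on the relevant
    part: [Phi], [h] on x > 0; [F] on t > 0; [T] on t >= 0; [u] on the closed
    quarter plane. *)

Definition is_right_derive (f : R -> R) (x l : R) : Prop :=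
  filterlim (fun y => (f y - f x) / (y - x)) (at_right x) (locally l).

Definition quarter_plane (p : R * R) : Prop := 0 <= fst p /\ 0 <= snd p.

Definition problemP_data (h : R -> R) : Prop :=
  filterlim h (at_right 0) (locally 0).

(** [u_x(0,t)] is the one-sided derivative [V], as [u] lives on x >= 0.
    [ex_derive_n _ 2] alone does not give differentiability near the point
    ([Derive] is total), hence the separate condition on the first derivative.
    Continuity on the closed quarter plane is what ties the initial and boundary
    values to the equation in the interior. *)
Record problemP_solution (Phi : R -> R) (F : R -> R -> R) (h : R -> R)
    (u : R -> R -> R) : Prop := {
  problemP_admissible : problemP_data h;
  problemP_continuous :
    continuous_on quarter_plane (fun p : R * R => u (fst p) (snd p));
  problemP_derive_t : forall x t, 0 < x -> 0 < t ->
    ex_derive (fun s => u x s) t;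
  problemP_derive_x : forall x t, 0 < x -> 0 < t ->
    ex_derive (fun y => u y t) x;
  problemP_derive_xx : forall x t, 0 < x -> 0 < t ->
    ex_derive_n (fun y => u y t) 2 x;
  problemP_equation : forall t, 0 < t -> exists V : R,
    is_right_derive (fun y => u y t) 0 V /\
    forall x, 0 < x ->
      Derive (fun s => u x s) t - Derive_n (fun y => u y t) 2 x
        = - Phi x * F V t;
  problemP_initial : forall x, 0 < x -> u x 0 = h x;
  problemP_boundary : forall t, 0 < t -> u 0 t = 0
}.

Definition separated_variables (u : R -> R -> R) : Prop :=
  exists X T : R -> R, forall x t, 0 <= x -> 0 <= t -> u x t = X x * T t.

Definition Xprofile (delta sigma x : R) : R :=
  if Rlt_dec 0 sigma then delta / sqrt sigma * sinh (sqrt sigma * x)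
  else if Rlt_dec sigma 0 then
    delta / sqrt (Rabs sigma) * sin (sqrt (Rabs sigma) * x)
  else delta * x.

Record ivp_solution (lambda eta delta sigma : R) (F : R -> R -> R)
    (T : R -> R) : Prop := {
  ivp_continuous : continuous_on (fun t => 0 <= t) T;
  ivp_derive : forall t, 0 < t -> ex_derive T t;
  ivp_equation : forall t, 0 < t ->
    Derive T t - sigma * T t = - lambda * F (delta * T t) t;
  ivp_initial : T 0 = eta
}.

(* Main.v *)
Require Import Defs.
From Stdlib Require Import Reals Lra.
From Coquelicot Require Import Coquelicot.
Open Scope R_scope.

(** In all three cases the profile X solves X'' = sigma X with X(0) = 0 and X'(0) = delta
    ([Xprofile_ode], [Xprofile_0]). Hence u_x(0,t) = delta T(t), which is exactly the argument of F
    in the equation for T, and u_t - u_xx = X (T' - sigma T) = - lambda X F(delta T, t) = - Phi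
    F(u_x(0,t), t). The initial and boundary values come from T(0) = eta and X(0) = 0. The remaining
    work is about domains: [u] is prescribed only on the closed quarter plane, so derivatives are
    transferred from X T to [u] by local agreement at interior points, and by a one-sided argument
    at x = 0. *)

Lemma is_derive_right_derive (f : R -> R) (x l : R) :
  is_derive f x l -> is_right_derive f x l.
Proof.
  intros Hf.
  apply is_derive_Reals in Hf.
  apply filterlim_locally; intros eps.
  destruct (Hf eps (cond_pos eps)) as [d Hd].
  exists d; intros y Hy Hxy.
  change (Rabs (y - x) < d) in Hy.
  change (Rabs ((f y - f x) / (y - x) - l) < eps).
  specialize (Hd (y - x)).
  rewrite Rplus_minus in Hd.
  apply Hd; [lra | exact Hy].
Qed.

(** The right difference quotient sees only the base point and points to its right. This matters at
    x = 0, where nothing is known about [u] on the left. *)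
Lemma is_right_derive_ext (f g : R -> R) (x l : R) :
  (forall y, x <= y -> f y = g y) ->
  is_right_derive f x l -> is_right_derive g x l.
Proof.
  intros Hfg Hf.
  apply (filterlim_ext_loc (fun y => (f y - f x) / (y - x))); [|exact Hf].
  exists (mkposreal 1 Rlt_0_1); intros y _ Hy.
  rewrite !Hfg; [reflexivity | lra | lra].
Qed.

Lemma Xprofile_0 (delta sigma : R) : Xprofile delta sigma 0 = 0.
Proof.
  unfold Xprofile.
  destruct (Rlt_dec 0 sigma); [|destruct (Rlt_dec sigma 0)];
    rewrite ?Rmult_0_r, ?sinh_0, ?sin_0; ring.
Qed.

(** The derivative is delta cosh, delta cos or delta, according to the sign of sigma. Packaging it
    existentially confines the case split to this proof. *)
Lemma Xprofile_ode (delta sigma : R) :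
  exists X' : R -> R, X' 0 = delta /\
    (forall x, is_derive (Xprofile delta sigma) x (X' x)) /\
    (forall x, is_derive X' x (sigma * Xprofile delta sigma x)).
Proof.
  unfold Xprofile.
  destruct (Rlt_dec 0 sigma) as [Hs|Hs]; [|destruct (Rlt_dec sigma 0) as [Hs'|Hs']].
  - assert (Hr := sqrt_lt_R0 _ Hs).
    assert (Hrr := sqrt_sqrt sigma (Rlt_le _ _ Hs)).
    exists (fun x => delta * cosh (sqrt sigma * x)); split; [|split].
    + rewrite Rmult_0_r, cosh_0; ring.
    + intros x; unfold sinh, cosh; auto_derive; [easy | field; lra].
    + intros x; unfold sinh, cosh; auto_derive; [easy|].
      (* Only the bare coefficient sigma becomes a square; those under the roots stay. *)
      rewrite <- Hrr at 5; field; lra.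
  - assert (Ha : 0 < Rabs sigma) by (apply Rabs_pos_lt; lra).
    assert (Hr := sqrt_lt_R0 _ Ha).
    assert (Hrr := sqrt_sqrt _ (Rlt_le _ _ Ha)).
    rewrite (Rabs_left sigma Hs') in *.
    exists (fun x => delta * cos (sqrt (- sigma) * x)); split; [|split].
    + rewrite Rmult_0_r, cos_0; ring.
    + intros x; auto_derive; [easy | field; lra].
    + intros x; auto_derive; [easy|].
      set (r := sqrt (- sigma)) in *.
      replace sigma with (- (r * r)) by lra; field; lra.
  - exists (fun _ => delta); split; [reflexivity | split].
    + intros x; auto_derive; [easy | ring].
    + intros x; auto_derive; [easy|].
      replace sigma with 0 by lra; ring.
Qed.

(** Each projection maps the neighbourhood filter within the product set to the one within its
    factor. The relative form is needed because T is continuous at 0 only from the right. *)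
Lemma continuous_on_tensor (A B : R -> Prop) (X T : R -> R) :
  continuous_on A X -> continuous_on B T ->
  continuous_on (fun p : R * R => A (fst p) /\ B (snd p))
    (fun p => X (fst p) * T (snd p)).
Proof.
  intros HX HT [x t] [Hx Ht]; simpl in Hx, Ht.
  apply (filterlim_comp_2 (G := locally (X x)) (H := locally (T t))
    (fun p => X (fst p)) (fun p => T (snd p)) Rmult).
  - apply (filterlim_comp _ _ _ fst X _ (within A (locally x))); [|exact (HX x Hx)].
    intros P [d Hd]; exists d; intros q [Hq _] [Aq _]; exact (Hd _ Hq Aq).
  - apply (filterlim_comp _ _ _ snd T _ (within B (locally t))); [|exact (HT t Ht)].
    intros P [d Hd]; exists d; intros q [_ Hq] [_ Bq]; exact (Hd _ Hq Bq).
  - exact (filterlim_mult (X x) (T t)).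
Qed.

Lemma locally_pos (x : R) : 0 < x -> locally x (fun y => 0 < y).
Proof. exact (open_gt 0 x). Qed.

Theorem theorem2p2 (lambda eta delta sigma : R)
    (Hlambda : lambda <> 0) (Heta : eta <> 0) (Hdelta : delta <> 0)
    (F : R -> R -> R) (T : R -> R)
    (HT : ivp_solution lambda eta delta sigma F T)
    (Phi h : R -> R)
    (HPhi : forall x, 0 < x -> Phi x = lambda * Xprofile delta sigma x)
    (Hh : forall x, 0 < x -> h x = eta * Xprofile delta sigma x)
    (u : R -> R -> R)
    (Hu : forall x t, 0 <= x -> 0 <= t -> u x t = Xprofile delta sigma x * T t) :
  problemP_solution Phi F h u /\ separated_variables u.
Proof.
  split; [|exists (Xprofile delta sigma), T; exact Hu].
  assert (HX0 := Xprofile_0 delta sigma).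
  destruct (Xprofile_ode delta sigma) as (X' & HX'0 & HX & HX').
  set (X := Xprofile delta sigma) in *.
  destruct HT as [Tcont Tder Teq Tini].
  assert (Xcont : forall x, continuous X x)
    by (intros x; apply (ex_derive_continuous X); exists (X' x); apply HX).
  assert (Hut : forall x t, 0 < x -> 0 < t ->
    locally t (fun s => X x * T s = u x s)).
  { intros x t Hx Ht; generalize (locally_pos t Ht); apply filter_imp.
    intros s Hs; rewrite Hu; [reflexivity | lra | lra]. }
  assert (Hux : forall x t, 0 < x -> 0 < t ->
    locally x (fun y => X y * T t = u y t)).
  { intros x t Hx Ht; generalize (locally_pos x Hx); apply filter_imp.
    intros y Hy; rewrite Hu; [reflexivity | lra | lra]. }
  assert (HXT : forall x t, is_derive (fun y => X y * T t) x (X' x * T t)).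
  { intros x t; apply (is_derive_scal_l X x (X' x) (T t)), HX. }
  assert (HXT2 : forall x t,
    is_derive (Derive (fun y => X y * T t)) x (sigma * X x * T t)).
  { intros x t; apply (is_derive_ext (fun y => X' y * T t)).
    - intros y; symmetry; apply is_derive_unique, HXT.
    - apply (is_derive_scal_l X' x (sigma * X x) (T t)), HX'. }
  constructor.
  - apply (filterlim_ext_loc (fun x => eta * X x)).
    + exists (mkposreal 1 Rlt_0_1); intros y _ Hy; rewrite Hh; [reflexivity | exact Hy].
    (* The two-sided limit suffices: X is continuous on the whole line and eta X(0) = 0. *)
    + apply (filterlim_filter_le_1 _ (filter_le_within (F := locally 0) _)).
      replace 0 with (eta * X 0) at 2 by (rewrite HX0; ring).
      exact (continuous_mult (fun _ => eta) X 0 (continuous_const eta 0) (Xcont 0)).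
  - apply (continuous_on_ext _ (fun p => X (fst p) * T (snd p))).
    + intros p [Hx Ht]; rewrite Hu; easy.
    + apply (continuous_on_tensor (fun x => 0 <= x) (fun t => 0 <= t)); [|exact Tcont].
      apply continuous_on_forall; intros x _; apply Xcont.
  - intros x t Hx Ht; apply (ex_derive_ext_loc _ _ _ (Hut x t Hx Ht)).
    apply ex_derive_scal, Tder, Ht.
  - intros x t Hx Ht; apply (ex_derive_ext_loc _ _ _ (Hux x t Hx Ht)).
    eexists; apply HXT.
  - intros x t Hx Ht; apply (ex_derive_n_ext_loc _ _ _ _ (Hux x t Hx Ht)).
    eexists; apply HXT2.
  (* The witness is u_x(0,t) = X'(0) T(t). *)
  - intros t Ht; exists (delta * T t); split.
    + apply (is_right_derive_ext (fun y => X y * T t)).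
      * intros y Hy; rewrite Hu; [reflexivity | lra | lra].
      * apply is_derive_right_derive; rewrite <- HX'0; apply HXT.
    + intros x Hx.
      assert (Dt : Derive (fun s => u x s) t = X x * Derive T t).
      { rewrite <- Derive_scal; symmetry; apply Derive_ext_loc, Hut; assumption. }
      assert (Dxx : Derive_n (fun y => u y t) 2 x = sigma * X x * T t).
      { rewrite <- (is_derive_unique _ _ _ (HXT2 x t)).
        symmetry; apply (Derive_n_ext_loc _ _ 2 _ (Hux x t Hx Ht)). }
      rewrite Dt, Dxx, HPhi by exact Hx.
      transitivity (X x * (Derive T t - sigma * T t)); [ring|].
      rewrite (Teq t Ht); ring.
  - intros x Hx; rewrite Hu, Hh by lra; fold X; rewrite Tini; ring.
  - intros t Ht; rewrite Hu by lra; rewrite HX0; ring.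
Qed.
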